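(* Fix an integer $r \geq 2$ and let $(H_n)_{n\ge1}$ be a sequence of $r$-uniform hypergraphs with $|E(H_n)| \to \infty$. Suppose the vertices of $H_n$ are colored uniformly at random with $c_n$ colors, where $c_n\to\infty$, such that $$\lim_{n \to \infty}\mathbb{E}\, T(H_n) = \lambda \quad\text{and}\quad \lim_{n \to \infty}\mathrm{Var}\, T(H_n) = \lambda,$$ for some constant $\lambda \geq 0$. Then, as $n \to \infty$, $T(H_n)$ converges in distribution to $\mathrm{Pois}(\lambda)$.
   Context: An $r$-uniform hypergraph $H=(V(H),E(H))$ consists of a finite vertex set $V(H)$ and a set $E(H)$ of $r$-element subsets of $V(H)$, called hyperedges. ''The vertices of $H_n$ are colored uniformly at random with $c_n$ colors'' means that each vertex $v\in V(H_n)$ gets a color $X_v$ uniform on $\{1,\dots,c_n\}$, independently over the vertices. A hyperedge $e$ is monochromatic if $X_v=X_{v'}$ for all $v,v'\in e$, and $T(H_n)$ is the number of monochromatic hyperedges of $H_n$, i.e. $T(H_n)=\sum_{e\in E(H_n)}\mathbf 1\{X_v=X_{v'}\ \forall v,v'\in e\}$. $\mathrm{Pois}(\lambda)$ is the Poisson distribution with mean $\lambda$; $\mathrm{Pois}(0)$ is the point mass at $0$. *)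

(* Defs.v *)
From HB Require Import structures.
From mathcomp Require Import all_boot all_order all_algebra.
From mathcomp Require Import all_classical all_reals all_analysis.
From mathcomp Require Import measurable_realfun.

Set Implicit Arguments.
Unset Strict Implicit.
Unset Printing Implicit Defensive.

Import Order.TTheory GRing.Theory Num.Theory.
Import numFieldNormedType.Exports.

Local Open Scope classical_set_scope.
Local Open Scope ring_scope.

Record hypergraph (r : nat) := Hypergraph {
  vertex : finType;
  hyperedges : {set {set vertex}};
  hyperedges_uniform : forall e, e \in hyperedges -> #|e| = r }.

Definition mutually_independent (R : realType) (d d' : measure_display)
    (Omega : measurableType d) (C : measurableType d')
    (P : probability Omega R) (V : finType) (X : V -> {RV P >-> C}) : Prop :=
  forall (J : {set V}) (A : V -> set C), (forall v, measurable (A v)) ->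
    P (\bigcap_(v in [set` J]) (X v @^-1` A v)) =
    (\prod_(v in J) P (X v @^-1` A v))%E.

Arguments mutually_independent {R d d' Omega C} P {V} X.

(* The law of Y is uniform on {1, ..., c}; for c = 0 no Y qualifies, since the
   prescribed masses do not add up to 1. *)
Definition uniform_color (R : realType) (d : measure_display)
    (Omega : measurableType d) (P : probability Omega R) (c : nat)
    (Y : {RV P >-> nat}) : Prop :=
  forall k : nat, distribution P Y [set k] =
    (if (1 <= k <= c)%N then c%:R^-1 else 0)%:E.

Arguments uniform_color {R d Omega} P c Y.

Definition uniform_random_coloring (R : realType) (d : measure_display)
    (Omega : measurableType d) (P : probability Omega R) (V : finType)
    (c : nat) (X : V -> {RV P >-> nat}) : Prop :=
  mutually_independent P X /\ forall v, uniform_color P c (X v).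

Arguments uniform_random_coloring {R d Omega} P {V} c X.

Definition monochromatic (V : finType) (x : V -> nat) (e : {set V}) : bool :=
  [forall v in e, forall v' in e, x v == x v'].

Definition mono_count (R : realType) (d : measure_display)
    (Omega : measurableType d) (r : nat) (H : hypergraph r)
    (X : vertex H -> {mfun Omega >-> nat}) : Omega -> R :=
  fun w => \sum_(e in hyperedges H) (monochromatic (fun v => X v w) e)%:R.

Arguments mono_count R {d Omega r H} X.

Lemma measurable_mono_count (R : realType) (d : measure_display)
    (Omega : measurableType d) (r : nat) (H : hypergraph r)
    (X : vertex H -> {mfun Omega >-> nat}) :
  measurable_fun [set: Omega] (mono_count R X).
Proof.
rewrite (_ : mono_count R X = fun w => \sum_e if e \in hyperedges H then
    \1_[set w | monochromatic (fun v => X v w) e] w else 0); last first.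
  apply/funext => w; rewrite /mono_count [LHS]big_mkcond/=.
  apply: eq_bigr => e _; case: ifP => // _; rewrite indicE.
  by congr (nat_of_bool _)%:R; apply/idP/idP; rewrite in_setE.
apply: measurable_sum => e.
case: (e \in hyperedges H); last exact: measurable_cst.
apply: measurable_indic.
rewrite (_ : mkset _ =
    \bigcap_(p in [set` finset.setX e e]) [set w | X p.1 w == X p.2 w]).
  apply: fin_bigcap_measurable => [|p _]; first exact: finite_finset.
  rewrite -[X in measurable X]setTI -preimage_true.
  by apply: measurable_fun_eqn => //; exact: measurable_funP.
apply/seteqP; split=> w /=.
  move=> /forall_inP ew [v v'] /=.
  by rewrite finset.in_setX => /andP[/ew/forall_inP]; exact.
move=> ew; apply/forall_inP => v ve; apply/forall_inP => v' v'e.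
by apply: (ew (v, v')); rewrite /= finset.in_setX ve.
Qed.

HB.instance Definition _ (R : realType) (d : measure_display)
    (Omega : measurableType d) (r : nat) (H : hypergraph r)
    (X : vertex H -> {mfun Omega >-> nat}) :=
  isMeasurableFun.Build _ _ _ _ (mono_count R X)
    (@measurable_mono_count R d Omega r H X).

Definition nat_to_real (R : realType) : nat -> R := fun k => k%:R.

HB.instance Definition _ (R : realType) :=
  isMeasurableFun.Build _ _ _ _ (@nat_to_real R)
    (fun _ (B : set R) _ =>
       I : measurable ([set: nat] `&` @nat_to_real R @^-1` B)).

(* Pois(lambda) as a law on R.  The second argument of poisson_prob occurs
   nowhere in its body; for lambda = 0 the measure is the point mass at 0. *)
Definition Pois (R : realType) (lambda : R) : probability R R :=
  distribution (poisson_prob lambda 0) (@nat_to_real R).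

(* Convergence of the distribution functions at every continuity point of the
   limiting one; the X n may live on different probability spaces. *)
Definition cvg_in_distribution (R : realType) (d : nat -> measure_display)
    (Omega : forall n, measurableType (d n))
    (P : forall n, probability (Omega n) R)
    (X : forall n, {RV (P n) >-> R})
    (mu : probability R R) : Prop :=
  forall x : R, {for x, continuous (fun t : R => mu `]-oo, t]%classic)} ->
    cdf (X n) x @[n --> \oo] --> mu `]-oo, x]%classic.

Arguments cvg_in_distribution {R d Omega} P X mu.

(* Main.v *)
Require Import Defs.
From HB Require Import structures.
From mathcomp Require Import all_boot all_order all_algebra.
From mathcomp Require Import all_classical all_reals all_analysis.
From mathcomp Require Import measurable_realfun ring lra zify.

Set Implicit Arguments.
Unset Strict Implicit.
Unset Printing Implicit Defensive.

Import Order.TTheory GRing.Theory Num.Theory.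
Import numFieldNormedType.Exports.

Local Open Scope classical_set_scope.
Local Open Scope ring_scope.

(** Let [T] be the number of monochromatic edges, [p = c ^- (r - 1)] the
    probability that a given edge is monochromatic, and [mu = E T].

    Conditioning on an edge [e] being monochromatic amounts to recoloring all
    of [e] with the color of one of its vertices [v] ([mean_collapse]).  Write
    [T^e] for the count after recoloring; then
      [(j + 1) P(T = j + 1) = p * (the sum over e of P(T^e = j + 1))].
    If [T^e] were always [T + 1], this would be the recursion
    [(j + 1) q_(j + 1) = mu q_j] of the Poisson weights.  Apart from the case
    that [e] is monochromatic already, which has probability [p], it fails
    only if some edge [f <> e] that meets [e] outside [v] is monochromatic
    before or after the recoloring.  There are two kinds of such [f].

    - [f] shares at least two vertices with [e].  Edges sharing at most one
      vertex are uncorrelated, and for the other pairs the covariance is,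
      as soon as [c >= 2], at least half of the probability that both are
      monochromatic.  So the total contribution [heavy] of these pairs is bounded by twice the excess of
      the variance over [mu - mu p] ([heavy_le]), and tends to [0].

    - [f] shares exactly one vertex with [e].  Each such pair contributes
      at most [2 p ^ 2], so it matters how many of them there are.  If [v] is
      a vertex of maximal degree in [e], only the degrees of the other vertices
      count, and each of them is a minimum of two degrees.  The sum [wedges] of
      these minima is estimated by the Cauchy-Schwarz inequality in terms of
      the squared codegrees, which again count pairs of edges with two common
      vertices ([wedges_sqr_le], [wedges_le]).

    Altogether the recursion holds up to an error that tends to [0]
    ([tally_recursion]).  It determines each [P(T = j)] up to the factor
    [P(T = 0)] in the limit, and Markov's inequality, which prevents mass from
    escaping to infinity, determines this factor
    ([cvg_poisson_of_recursion]). *)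

(** * Averages over colorings *)

Section averages.
Variables (R : realFieldType) (V : finType) (c : nat).
Implicit Types (F G : (V -> nat) -> R) (e f : {set V}) (y : V -> nat).

(** Colors are numbered from 1, as in [uniform_color]. *)
Definition shade (x : {ffun V -> 'I_c}) : V -> nat := fun v => (x v).+1.

(** The expectation of [F] for a uniformly random coloring. *)
Definition mean F : R := (c ^ #|V|)%:R^-1 * \sum_x F (shade x).

Definition collapse e (v u : V) : V := if u \in e then v else u.

Lemma eq_mean F G : F =1 G -> mean F = mean G.
Proof. by move=> FG; congr (_ * _); apply: eq_bigr. Qed.

Lemma meanD F G : mean (fun y => F y + G y) = mean F + mean G.
Proof. by rewrite /mean big_split mulrDr. Qed.

Lemma meanZ a F : mean (fun y => a * F y) = a * mean F.
Proof. by rewrite /mean -mulr_sumr mulrCA. Qed.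

Lemma mean_sum (I : Type) (s : seq I) (Q : pred I) (F : I -> (V -> nat) -> R) :
  mean (fun y => \sum_(i <- s | Q i) F i y) = \sum_(i <- s | Q i) mean (F i).
Proof. by rewrite /mean exchange_big mulr_sumr. Qed.

Lemma ler_mean F G : (forall y, F y <= G y) -> mean F <= mean G.
Proof.
by move=> FG; rewrite ler_wpM2l ?invr_ge0 ?ler0n// ler_sum.
Qed.

Lemma mean_ge0 F : (forall y, 0 <= F y) -> 0 <= mean F.
Proof.
by move=> F0; rewrite mulr_ge0 ?invr_ge0 ?ler0n// sumr_ge0.
Qed.

Lemma mean_dist F G (D : (V -> nat) -> R) : (forall y, `|F y - G y| <= D y) ->
  `|mean F - mean G| <= mean D.
Proof.
move=> FGD; have -> : mean F - mean G = mean (fun y => F y - G y).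
  rewrite meanD -mulN1r -meanZ; congr (_ + _).
  by apply: eq_mean => y; rewrite mulN1r.
rewrite ler_norml -mulN1r -meanZ; apply/andP; split; apply: ler_mean => y.
  by rewrite mulN1r; have := FGD y; rewrite ler_norml => /andP[].
by have := FGD y; rewrite ler_norml => /andP[].
Qed.

Hypothesis c_gt0 : (0 < c)%N.

Let cR_neq0 : c%:R != 0 :> R. Proof. by rewrite pnatr_eq0 -lt0n. Qed.

Lemma mean_cst a : mean (fun=> a) = a.
Proof.
rewrite /mean sumr_const card_ffun card_ord -[a *+ _]mulr_natl mulKf//.
by rewrite pnatr_eq0 expn_eq0 negb_and -lt0n c_gt0.
Qed.

(** Since [y \o collapse e v] is the coloring [y] after recoloring [e] with the
    color of [v], whether [f] becomes monochromatic can be read off from [y] on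
    the image of [f]. *)
Lemma monochromatic_collapse e f v y : v \in e ->
  monochromatic (y \o collapse e v) f = monochromatic y (collapse e v @: f).
Proof.
move=> ve; apply/forall_inP/forall_inP => [fm _ /imsetP[u uf ->]|fm u uf].
  apply/forall_inP => _ /imsetP[u' uf' ->].
  exact: (forall_inP (fm _ uf)).
by apply/forall_inP => u' uf'; apply: (forall_inP (fm _ (imset_f _ uf)));
  exact: imset_f.
Qed.

(** Recoloring [e] with the color of [v] maps the colorings onto those for
    which [e] is monochromatic, and the fibres are all of the same size: the
    fibre of [x] consists of the colorings that agree with [x] off
    [e :\ v]. *)
Lemma sum_collapse F e v : v \in e ->
  \sum_x F (shade x \o collapse e v) =
  c%:R ^+ #|e|.-1 * \sum_x (monochromatic (shade x) e)%:R * F (shade x).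
Proof.
move=> ve; pose phi (x : {ffun V -> 'I_c}) := [ffun u => x (collapse e v u)].
have phiE x : shade x \o collapse e v = shade (phi x).
  by apply/funext => u; rewrite /shade /= ffunE.
under eq_bigr do rewrite phiE.
rewrite (partition_big phi xpredT)//= mulr_sumr; apply: eq_bigr => x _.
rewrite (eq_bigr (fun=> F (shade x))); last by move=> z /eqP ->.
rewrite sumr_const -[F _ *+ _]mulr_natl mulrA; congr (_ * _); rewrite -natrX -natrM.
congr (_%:R); have [me|nme] := boolP (monochromatic _ _); last first.
  rewrite muln0; apply: eq_card0 => z; apply: contraNF nme => zx.
  have <- : phi z = x by apply/eqP.
  apply/forall_inP => u ue.
  by apply/forall_inP => u' ue'; rewrite -phiE /= /collapse ue ue'.
rewrite muln1 (@eq_card _ _ (family (fun u =>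
  if u \in e :\ v then predT else pred1 (x u)))); last first.
  move=> z; apply/idP/familyP => [zx u|zx].
    have <- : phi z = x by apply/eqP.
    rewrite ffunE /collapse !inE; case: eqVneq => [->|_] /=.
      by rewrite ve inE.
    by case: (u \in e); [|exact/eqP].
  suff /eqP : phi z = x by [].
  apply/ffunP => u; rewrite ffunE /collapse; have := zx u; have := zx v.
  rewrite !inE eqxx /= inE => /eqP zv; case: eqVneq => [->|uv] /=.
    by rewrite ve inE.
  case: ifP => [ue _|_]; last by rewrite inE => /eqP.
  have /forall_inP/(_ u ue)/eqP := forall_inP me v ve.
  by rewrite zv => -[]; exact: val_inj.
rewrite card_family foldrE big_image/=.
rewrite (eq_bigr (fun u => if u \in e :\ v then c else 1)%N); last first.
  by move=> u _; case: ifP => _; rewrite ?card1// card_ord.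
by rewrite -big_mkcond prod_nat_const (cardsD1 v e) ve.
Qed.

(** The law of a random coloring conditioned on [e] being monochromatic is the
    law of the coloring recolored on [e]. *)
Lemma mean_collapse F e v : v \in e ->
  mean (fun y => (monochromatic y e)%:R * F y) =
  c%:R ^- #|e|.-1 * mean (fun y => F (y \o collapse e v)).
Proof.
move=> ve; rewrite /mean (sum_collapse _ ve) mulrCA mulKf//.
by rewrite expf_neq0.
Qed.

Lemma mean_monochromatic e : e != finset.set0 ->
  mean (fun y => (monochromatic y e)%:R) = c%:R ^- #|e|.-1.
Proof.
move=> /set0Pn[v ve]; have /= := mean_collapse (fun=> 1) ve.
rewrite mean_cst mulr1 => <-.
by apply: eq_mean => y; rewrite mulr1.
Qed.

Definition both e f : R :=
  mean (fun y => (monochromatic y e)%:R * (monochromatic y f)%:R).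

Lemma bothE e f v : v \in e -> f != finset.set0 ->
  both e f = c%:R ^- #|e|.-1 * c%:R ^- #|collapse e v @: f|.-1.
Proof.
move=> ve f0; rewrite /both (mean_collapse _ ve); congr (_ * _).
rewrite -mean_monochromatic ?imset_eq0//; apply: eq_mean => y.
by rewrite monochromatic_collapse.
Qed.

(** With at most one vertex of [f] in [e], recoloring [e] identifies no two
    vertices of [f]. *)
Lemma both_indep e f : e != finset.set0 -> f != finset.set0 ->
  (#|e :&: f| <= 1)%N -> both e f = c%:R ^- #|e|.-1 * c%:R ^- #|f|.-1.
Proof.
move=> /set0Pn[v ve] f0 ef1; rewrite (bothE ve f0) card_in_imset//.
have ef u w : u \in e -> w \in e -> u \in f -> w \in f -> u = w.
  by move=> ue we uf wf; apply: (card_le1_eqP ef1); rewrite inE ?ue ?we.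
move=> u w uf wf; rewrite /collapse.
case: ifP => ue; case: ifP => we //; first by move=> _; exact: ef.
  by move=> vw; rewrite -vw ve in we.
by move=> vw; rewrite vw ve in ue.
Qed.

(** Two common vertices are identified by recoloring [e], so that [f] then has
    at least one constraint less and gains a factor [c] or more in probability. *)
Lemma both_overlap e f : (1 < c)%N -> (1 < #|e :&: f|)%N ->
  c%:R ^- #|e|.-1 * c%:R ^- #|f|.-1 <= both e f / 2.
Proof.
move=> c1 /card_gt1P[u [w [+ + uw]]]; rewrite !inE.
move=> /andP[ue uf] /andP[we wf].
have f0 : f != finset.set0 by apply/set0Pn; exists u.
rewrite (bothE ue f0) -mulrA ler_wpM2l ?invr_ge0 ?exprn_ge0//.
have lt_im : (#|collapse e u @: f| < #|f|)%N.
  rewrite ltn_neqAle leq_imset_card andbT; apply/imset_injP => inj.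
  by move/eqP: uw; apply; apply: inj => //; rewrite /collapse ue we.
have im0 : (0 < #|collapse e u @: f|)%N.
  by rewrite card_gt0 imset_eq0.
rewrite -invfM lef_pV2 ?posrE ?mulr_gt0 ?exprn_gt0 ?ltr0n//.
have -> : (#|f|.-1 = #|collapse e u @: f|.-1.+1 + (#|f| - #|collapse e u @: f|).-1)%N.
  by lia.
rewrite exprD exprSr -mulrA ler_wpM2l ?exprn_ge0// -natrX -natrM ler_nat.
by rewrite -[leqLHS]muln1 leq_mul// expn_gt0 c_gt0.
Qed.

Lemma both_ge e f : (1 < c)%N -> e != finset.set0 -> f != finset.set0 ->
  c%:R ^- #|e|.-1 * c%:R ^- #|f|.-1 <= both e f.
Proof.
move=> c1 e0 f0; have [ef1|ef1] := leqP #|e :&: f| 1.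
  by rewrite both_indep.
apply: le_trans (both_overlap c1 ef1) _.
by rewrite ler_pdivrMr// ler_peMr ?ler1n// mean_ge0// => y; rewrite mulr_ge0.
Qed.

End averages.
(** * Counting pairs of edges *)

Section edge_counts.
Variables (V : finType) (E : {set {set V}}).
Implicit Types (e f : {set V}) (u v w : V) (y : V -> nat).

Definition tally y : nat := (\sum_(e in E) monochromatic y e)%N.

Definition deg u : nat := (\sum_(e in E) (u \in e))%N.

Definition codeg u w : nat := (\sum_(e in E) ((u \in e) && (w \in e)))%N.

(** Ordered pairs of edges with at least two common vertices; the diagonal
    is included, as in the expansion of the squared codegrees. *)
Definition overlaps : nat := (\sum_(e in E) \sum_(f in E) (1 < #|e :&: f|))%N.

(** For each edge [e], the inner double sum dominates the sum of the degrees of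
    the vertices of [e] other than one of maximal degree, without singling out
    such a vertex. *)
Definition wedges : nat :=
  (\sum_(e in E) \sum_(u in e) \sum_(w in e | w != u) minn (deg u) (deg w))%N.

Definition touches e v f := ~~ [disjoint f & e :\ v].

(** An edge that does not touch [e :\ v] keeps its colors, and [e] itself becomes
    monochromatic. *)
Lemma tally_collapse e v y : e \in E -> v \in e ->
  ((tally (y \o collapse e v) != (tally y).+1) <=
   monochromatic y e + \sum_(f in E | (f != e) && touches e v f)
     (monochromatic y f + monochromatic (y \o collapse e v) f))%N.
Proof.
move=> eE ve; set n := (_ + _)%N; case: (posnP n) => [|n0]; last first.
  exact: leq_trans (leq_b1 _) n0.
move/eqP; rewrite addn_eq0 sum_nat_eq0 eqb0 => /andP[/negPf ne /forall_inP nf].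
suff -> : tally (y \o collapse e v) = (tally y).+1 by rewrite eqxx.
have splitE z : tally z = (monochromatic z e +
    \sum_(f in E | f != e) monochromatic z f)%N.
  by rewrite /tally (bigD1 e).
rewrite !splitE ne add0n.
have -> : monochromatic (y \o collapse e v) e.
  apply/forall_inP => u ue; apply/forall_inP => w we.
  by rewrite /= /collapse ue we.
rewrite add1n; congr S; apply: eq_bigr => f /andP[fE fe].
have [] := boolP (touches e v f) => ef.
  have := nf f; rewrite fE fe ef => /(_ isT).
  by rewrite addn_eq0 => /andP[/eqP -> /eqP ->].
move: ef; rewrite negbK => ef; congr nat_of_bool.
have fK u : u \in f -> collapse e v u = u.
  move=> uf; rewrite /collapse; case: ifP => // ue.
  by have := disjointFr ef uf; rewrite !inE ue andbT => /negbFE/eqP.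
rewrite monochromatic_collapse//; congr (monochromatic y).
rewrite -[RHS]imset_id; exact: eq_in_imset.
Qed.

Lemma sum_touches e v :
  (\sum_(f in E) touches e v f <= \sum_(u in e :\ v) deg u)%N.
Proof.
rewrite exchange_big; apply: leq_sum => f _.
rewrite /touches; case: (boolP [disjoint _ & _]) => //=.
case/pred0Pn => u /= /andP[uf ue]; rewrite (bigD1 u)//= uf.
by rewrite leq_addr.
Qed.

Lemma sum_deg_le_min e v : v \in e -> (forall w, w \in e -> (deg w <= deg v)%N) ->
  (\sum_(u in e :\ v) deg u <=
   \sum_(u in e) \sum_(w in e | w != u) minn (deg u) (deg w))%N.
Proof.
move=> ve vmax; rewrite [leqRHS](bigD1 v)//= -[leqLHS]add0n leq_add//.
rewrite (eq_bigl (fun u => (u \in e) && (u != v))); last first.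
  by move=> u; rewrite !inE andbC.
apply: leq_sum => u /andP[ue uv]; rewrite (bigD1 v)/=; last first.
  by rewrite ve eq_sym.
by rewrite (minn_idPl (vmax _ ue)) leq_addr.
Qed.

Lemma wedgesE : wedges =
  (\sum_(i : V * V | i.2 != i.1) codeg i.1 i.2 * minn (deg i.1) (deg i.2))%N.
Proof.
rewrite -(pair_big_dep xpredT (fun u w => w != u)
  (fun u w => codeg u w * minn (deg u) (deg w))%N)/= /wedges.
under [RHS]eq_bigr => u _ do
  (under eq_bigr => w _ do rewrite big_distrl/=; rewrite exchange_big/=).
rewrite [RHS]exchange_big/=; apply: eq_bigr => e _.
rewrite big_mkcond; apply: eq_bigr => u _; case: ifP => ue; last first.
  by rewrite big1// => w _; rewrite mul0n.
rewrite big_mkcondl; apply: eq_bigr => w _.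
by case: ifP; rewrite ?mul1n ?mul0n.
Qed.

Variable r : nat.
Hypothesis E_uniform : forall e, e \in E -> #|e| = r.

Lemma sum_deg : (\sum_u deg u = #|E| * r)%N.
Proof.
rewrite exchange_big/= -sum_nat_const; apply: eq_bigr => e eE.
by rewrite -(E_uniform eE) -sum1_card [RHS]big_mkcond; apply: eq_bigr.
Qed.

(** The squared codegrees count pairs of edges together with two distinct
    common vertices. *)
Lemma sum_sqr_codeg :
  (\sum_(i : V * V | i.2 != i.1) codeg i.1 i.2 ^ 2 <= r ^ 2 * overlaps)%N.
Proof.
rewrite (eq_bigr (fun i => \sum_(e in E) \sum_(f in E)
  (((i.1 \in e) && (i.2 \in e)) * ((i.1 \in f) && (i.2 \in f))))%N); last first.
  move=> i _; rewrite expnS expn1 /codeg big_distrl/=.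
  by apply: eq_bigr => e _; rewrite big_distrr.
rewrite exchange_big/= /overlaps big_distrr; apply: leq_sum => e eE.
rewrite exchange_big/= big_distrr; apply: leq_sum => f fE.
rewrite (eq_bigr (fun i =>
  nat_of_bool (i \in finset.setX (e :&: f) (e :&: f)))); last first.
  by move=> [u w] _; rewrite /= finset.in_setX !inE mulnb andbACA.
case: leqP => ef1; rewrite /= ?muln0 ?muln1.
  rewrite leqn0 sum_nat_eq0; apply/forall_inP => -[u w]/= wu.
  rewrite finset.in_setX eqb0; apply: contra wu => /andP[ui wi].
  by apply/eqP/(card_le1_eqP ef1).
apply: (@leq_trans #|finset.setX (e :&: f) (e :&: f)|).
  rewrite -sum1_card [leqLHS]big_mkcond [leqRHS]big_mkcond/=.
  by apply: leq_sum => i _; case: ifP => _; case: (i \in _).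
rewrite cardsX -mulnn -(E_uniform eE).
by apply: leq_mul; apply: subset_leq_card; exact: finset.subsetIl.
Qed.

End edge_counts.

Lemma cauchy_schwarz_sum (R : realFieldType) (I : finType) (Q : pred I)
    (a b : I -> R) :
  (\sum_(i | Q i) a i * b i) ^+ 2 <=
  (\sum_(i | Q i) a i ^+ 2) * (\sum_(i | Q i) b i ^+ 2).
Proof.
have : 0 <= \sum_(i | Q i) \sum_(j | Q j) (a i * b j - a j * b i) ^+ 2.
  by apply: sumr_ge0 => i _; apply: sumr_ge0 => j _; exact: sqr_ge0.
rewrite (eq_bigr (fun i => \sum_(j | Q j) a i ^+ 2 * b j ^+ 2 +
  \sum_(j | Q j) b i ^+ 2 * a j ^+ 2 -
  2 * \sum_(j | Q j) (a i * b i) * (a j * b j))); last first.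
  move=> i _; rewrite -big_split/= mulr_sumr -sumrB; apply: eq_bigr => j _.
  by ring.
rewrite sumrB big_split/= -mulr_sumr -!big_distrlr/=.
rewrite expr2 -subr_ge0; lra.
Qed.

(** Grouped by pairs of vertices, [wedges] is a sum of products of a codegree
    and a minimum of two degrees; the square of that minimum is at most the
    product of the degrees, whose sum over all pairs is the square of the sum
    of the degrees. *)
Lemma wedges_sqr_le (R : realFieldType) (V : finType) (E : {set {set V}})
    (r : nat) (E_uniform : forall e, e \in E -> #|e| = r) :
  (wedges E)%:R ^+ 2 <= (r ^ 2 * overlaps E)%:R * (#|E| * r)%:R ^+ 2 :> R.
Proof.
rewrite wedgesE natr_sum; under eq_bigr do rewrite natrM.
apply: le_trans (cauchy_schwarz_sum _ _ _) _.
apply: ler_pM; rewrite ?sumr_ge0//.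
  by under eq_bigr do rewrite -natrX; rewrite -natr_sum ler_nat sum_sqr_codeg.
under eq_bigr do rewrite -natrX.
rewrite -natr_sum -natrX ler_nat -(sum_deg E_uniform) -mulnn big_distrlr/=.
rewrite pair_big/= [leqLHS]big_mkcond; apply: leq_sum => -[u w] _ /=.
by case: ifP => // _; rewrite -mulnn leq_mul ?geq_minl ?geq_minr.
Qed.

(** * The approximate Poisson recursion *)

Section uniform_coloring.
Variables (R : rcfType) (V : finType) (E : {set {set V}}) (r c : nat).
Hypotheses (r_gt1 : (1 < r)%N) (c_gt1 : (1 < c)%N).
Hypothesis E_uniform : forall e, e \in E -> #|e| = r.
Implicit Types (e f : {set V}) (u v w : V) (y : V -> nat) (F G : (V -> nat) -> R).

Local Notation mean := (@mean R V c).
Local Notation both := (@both R V c).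
Local Notation p := (c%:R ^- r.-1 : R).
Local Notation mu := (#|E|%:R * p : R).

(** The part of [E (T ^+ 2)] due to distinct edges with at least two
    common vertices. *)
Definition heavy : R :=
  \sum_(e in E) \sum_(f in E | (f != e) && (1 < #|e :&: f|)%N) both e f.

Let c_gt0 : (0 < c)%N. Proof. exact: ltnW. Qed.

Let p_ge0 : 0 <= p. Proof. by rewrite invr_ge0 exprn_ge0. Qed.

Let edge_neq0 e : e \in E -> e != finset.set0.
Proof. by move=> eE; rewrite -card_gt0 (E_uniform eE) ltnW. Qed.

Let both_ge0 e f : 0 <= both e f.
Proof. by apply: mean_ge0 => y; rewrite mulr_ge0. Qed.

Let mean_edge e : e \in E -> mean (fun y => (monochromatic y e)%:R) = p.
Proof.
by move=> eE; rewrite mean_monochromatic ?edge_neq0// (E_uniform eE).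
Qed.

Let both_edge_ge e f : e \in E -> f \in E -> p * p <= both e f.
Proof.
move=> eE fE; have := both_ge R c_gt0 c_gt1 (edge_neq0 eE) (edge_neq0 fE).
by rewrite (E_uniform eE) (E_uniform fE).
Qed.

Let sum_edges (a : R) : \sum_(e in E) a = #|E|%:R * a.
Proof. by rewrite sumr_const -[LHS]mulr_natl. Qed.

Lemma heavy_ge0 : 0 <= heavy.
Proof. by apply: sumr_ge0 => e _; apply: sumr_ge0. Qed.

Lemma mean_tally : mean (fun y => (tally E y)%:R) = mu.
Proof.
rewrite (eq_mean _ (fun y => natr_sum _ _ _ _)).
rewrite mean_sum (eq_bigr (fun=> p)); last by move=> e; exact: mean_edge.
by rewrite sum_edges.
Qed.

(** The vertex [v] that gives its color to [e] is taken of maximal degree.  The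
    three error terms are due to [e] being monochromatic already, to the edges
    that share at least two vertices with [e], and to those that share a single
    vertex different from [v]. *)
Lemma edge_recursion e j : e \in E ->
  `|mean (fun y => (monochromatic y e)%:R * (tally E y == j.+1)%:R) -
    p * mean (fun y => (tally E y == j)%:R)| <=
  p * p + 2 * \sum_(f in E | (f != e) && (1 < #|e :&: f|)%N) both e f +
  2 * (p * p) * (\sum_(u in e) \sum_(w in e | w != u)
                   minn (deg E u) (deg E w))%:R.
Proof.
move=> eE; have /set0Pn[v0 v0e] := edge_neq0 eE.
have [v ve vmax] : exists2 v, v \in e &
    forall w, w \in e -> (deg E w <= deg E v)%N.
  by exists [arg max_(v > v0 in e) deg E v]; case: arg_maxnP.
rewrite (mean_collapse c_gt0 _ ve) (E_uniform eE) -mulrBr normrM ger0_norm//.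
(* [D] bounds the indicator of the event that recoloring [e] changes the
   count by something else than 1. *)
pose D y : R := (monochromatic y e)%:R +
  \sum_(f in E | (f != e) && touches e v f)
    ((monochromatic y f)%:R + (monochromatic (y \o collapse e v) f)%:R).
apply: (@le_trans _ _ (p * mean D)).
  rewrite ler_wpM2l//; apply: mean_dist => y.
  apply: (@le_trans _ _ (tally E (y \o collapse e v) != (tally E y).+1)%:R).
    move: (tally E (y \o _)) (tally E y) => a b.
    have [->|_] := eqVneq a b.+1; first by rewrite eqSS subrr normr0.
    by case: (_ == _); case: (_ == _);
      rewrite ?subrr ?subr0 ?sub0r ?normrN ?normr0 ?normr1.
  have := tally_collapse y eE ve; rewrite -(ler_nat R) => /le_trans; apply.
  rewrite natrD natr_sum lerD2l le_eqVlt; apply/orP; left; apply/eqP.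
  by apply: eq_bigr => f _; rewrite natrD.
rewrite meanD mean_sum mean_edge// mulrDr -addrA lerD2l mulr_sumr.
apply: (@le_trans _ _ (\sum_(f in E)
  ((if (f != e) && (1 < #|e :&: f|)%N then 2 * both e f else 0) +
   2 * (p * p) * (touches e v f)%:R))); last first.
  rewrite big_split/= -big_mkcondr -mulr_sumr lerD2l -mulr_sumr.
  rewrite ler_wpM2l ?mulr_ge0// -natr_sum ler_nat.
  exact: leq_trans (sum_touches _ _ _) (sum_deg_le_min ve vmax).
rewrite big_mkcondr; apply: ler_sum => f fE.
have [->|fe] /= := eqVneq f e; first by rewrite add0r mulr_ge0 ?mulr_ge0.
have [tf|tf] := boolP (touches e v f); last first.
  by rewrite mulr0 addr0; case: ifP => // _; rewrite mulr_ge0.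
have -> : p * mean (fun y => (monochromatic y f)%:R +
    (monochromatic (y \o collapse e v) f)%:R) = p * p + both e f.
  rewrite meanD mulrDr mean_edge//; congr (_ + _).
  rewrite /both (mean_collapse c_gt0 _ ve) (E_uniform eE); congr (_ * _).
have pb := both_edge_ge eE fE; have p0 := both_ge0 e f.
have pp0 : 0 <= p * p by rewrite mulr_ge0.
rewrite mulr1; case: ifPn => [_|]; first lra.
rewrite -leqNgt => ef1; rewrite both_indep ?edge_neq0//.
by rewrite (E_uniform eE) (E_uniform fE); lra.
Qed.

(** The expectation of [T] on the event [T = j + 1] is a sum over the
    edges, to which the bounds for single edges are applied. *)
Lemma tally_recursion j :
  `|j.+1%:R * mean (fun y => (tally E y == j.+1)%:R) -
    mu * mean (fun y => (tally E y == j)%:R)| <=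
  mu * p + 2 * heavy + 2 * (p * p * (wedges E)%:R).
Proof.
have -> : j.+1%:R * mean (fun y => (tally E y == j.+1)%:R) = \sum_(e in E)
    mean (fun y => (monochromatic y e)%:R * (tally E y == j.+1)%:R).
  rewrite -meanZ -mean_sum; apply: eq_mean => y.
  rewrite -mulr_suml -natr_sum -/(tally E y).
  by case: eqVneq => [->|]; rewrite ?mulr0.
have -> : mu * mean (fun y => (tally E y == j)%:R) =
    \sum_(e in E) p * mean (fun y => (tally E y == j)%:R).
  by rewrite sum_edges mulrA.
rewrite -sumrB; apply: le_trans (ler_norm_sum _ _ _) _.
apply: le_trans (ler_sum _ (fun e eE => edge_recursion j eE)) _.
rewrite !big_split/= sum_edges -!mulr_sumr mulrA -natr_sum.
by rewrite -/(wedges E) -/heavy -!mulrA.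
Qed.

(** Two edges are both monochromatic with probability at least [p * p]; the
    diagonal pairs contribute the term [mu * p]. *)
Lemma overlaps_le : p * p * (overlaps E)%:R <= heavy + mu * p.
Proof.
have -> : mu * p = \sum_(e in E) p * p.
  by rewrite sum_edges mulrA.
rewrite /overlaps natr_sum mulr_sumr -big_split/=; apply: ler_sum => e eE.
rewrite natr_sum mulr_sumr (bigD1 e)//= addrC lerD//.
  rewrite [leRHS]big_mkcondr [leLHS]big_mkcondr/=.
  apply: ler_sum => f fE; case: (f != e) => //=.
  by case: ifP => _; rewrite ?mulr0 ?mulr1// both_edge_ge.
by rewrite ler_piMr ?mulr_ge0// lern1 leq_b1.
Qed.

Lemma wedges_le :
  p * p * (wedges E)%:R <= r%:R ^+ 2 * mu * Num.sqrt (heavy + mu * p).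
Proof.
have hm : 0 <= heavy + mu * p by rewrite addr_ge0 ?heavy_ge0 ?mulr_ge0.
rewrite -[leLHS]ger0_norm ?mulr_ge0// -sqrtr_sqr.
rewrite -[r%:R ^+ 2 * mu]ger0_norm ?mulr_ge0 ?exprn_ge0// -sqrtr_sqr.
rewrite -sqrtrM ?exprn_ge0 ?mulr_ge0 ?exprn_ge0//; apply: ler_wsqrtr.
rewrite exprMn; apply: (@le_trans _ _ ((p * p) ^+ 2 *
  ((r ^ 2 * overlaps E)%:R * (#|E| * r)%:R ^+ 2))).
  by rewrite ler_wpM2l ?exprn_ge0 ?mulr_ge0// wedges_sqr_le.
have -> : (p * p) ^+ 2 * ((r ^ 2 * overlaps E)%:R * (#|E| * r)%:R ^+ 2) =
    (r%:R ^+ 2 * mu) ^+ 2 * (p * p * (overlaps E)%:R).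
  by rewrite !natrM; ring.
by rewrite ler_wpM2l ?exprn_ge0 ?mulr_ge0 ?exprn_ge0// overlaps_le.
Qed.

Lemma mean_tally_variance :
  mean (fun y => ((tally E y)%:R - mu) ^+ 2) =
  \sum_(e in E) \sum_(f in E) (both e f - p * p).
Proof.
have -> : mean (fun y => ((tally E y)%:R - mu) ^+ 2) =
    mean (fun y => (tally E y)%:R ^+ 2) - mu ^+ 2.
  rewrite (@eq_mean _ _ _ _ (fun y => (tally E y)%:R ^+ 2 +
    (- 2 * mu * (tally E y)%:R + mu ^+ 2))); last by move=> y; ring.
  by rewrite !meanD meanZ mean_tally mean_cst//; ring.
under [RHS]eq_bigr do rewrite sumrB.
rewrite sumrB; congr (_ - _).
  under [RHS]eq_bigr do rewrite -mean_sum.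
  rewrite -mean_sum; apply: eq_mean => y.
  by rewrite expr2 -[in RHS]big_distrlr/= -natr_sum.
by rewrite !sum_edges; ring.
Qed.

(** All covariances of distinct edges are nonnegative, and by [both_overlap]
    those of the pairs in [heavy] are at least half of [both]. *)
Lemma heavy_le :
  heavy <= 2 * (mean (fun y => ((tally E y)%:R - mu) ^+ 2) - mu + mu * p).
Proof.
rewrite mean_tally_variance -ler_pdivrMl//.
have -> : mu = \sum_(e in E) p by rewrite sum_edges.
rewrite mulr_suml -sumrB -big_split/= mulr_sumr; apply: ler_sum => e eE.
rewrite [X in _ <= X - _ + _](bigD1 e)//=.
have -> : both e e = p.
  rewrite -(mean_edge eE); apply: eq_mean => y.
  by rewrite -natrM mulnb andbb.
set S := \sum_(f in E | f != e) _.
have -> : p - p * p + S - p + p * p = S by ring.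
rewrite mulr_sumr big_mkcondr [leRHS]big_mkcondr/=.
apply: ler_sum => f fE; case: (f != e) => //=; case: ifP => ef.
  have := both_overlap R c_gt0 c_gt1 ef.
  by rewrite (E_uniform eE) (E_uniform fE); lra.
by rewrite subr_ge0 both_edge_ge.
Qed.

(** The lower bound is Markov's inequality. *)
Lemma tally_tail K : (0 < K)%N ->
  1 - mu / K%:R <= \sum_(j < K) mean (fun y => (tally E y == j)%:R) <= 1.
Proof.
move=> K0; rewrite -mean_sum.
have sumE y : \sum_(j < K) (tally E y == j)%:R = (tally E y < K)%N%:R :> R.
  rewrite -natr_sum; congr _%:R; case: ltnP => tK.
    rewrite (bigD1 (Ordinal tK))//= eqxx big1// => i.
    by rewrite -val_eqE/= eq_sym => /negPf ->.
  by rewrite big1// => i _; rewrite gtn_eqF// (leq_trans _ tK).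
under eq_mean do rewrite sumE.
apply/andP; split; last first.
  by rewrite -[leRHS](mean_cst V c_gt0); apply: ler_mean => y; case: (_ < _)%N.
rewrite lerBlDr -mean_tally mulrC -meanZ -meanD -[leLHS](mean_cst V c_gt0).
apply: ler_mean => y; case: ltnP => yK; rewrite ?add0r ?lerDl//.
by rewrite ler_pdivlMl ?ltr0n// mulr1 ler_nat.
Qed.

End uniform_coloring.

(** * From random colorings to averages *)

Section coloring_law.
Variables (R : realType) (d : measure_display) (Omega : measurableType d).
Variables (P : probability Omega R) (V : finType) (c : nat).
Variable X : V -> {RV P >-> nat}.
Hypotheses (c_gt0 : (0 < c)%N) (X_coloring : uniform_random_coloring P c X).
Local Open Scope ereal_scope.

Let cell (x : {ffun V -> 'I_c}) : set Omega :=
  \bigcap_(v in [set` [set: V]%SET]) (X v @^-1` [set shade x v]).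

Let cellP x w : cell x w -> (fun v => X v w) = shade x.
Proof. by move=> xw; apply/funext => v; apply: xw; rewrite /= finset.in_setT. Qed.

Let measurable_cell x : measurable (cell x).
Proof.
apply: fin_bigcap_measurable => [|v _]; first exact: finite_finset.
by rewrite -[_ @^-1` _]setTI; exact: measurable_funP.
Qed.

Let trivIset_cell : trivIset [set: {ffun V -> 'I_c}] cell.
Proof.
move=> x x' _ _ [w [/cellP xw /cellP]]; rewrite xw => xx'.
apply/ffunP => v; apply/val_inj.
by have /(congr1 (fun y => (y v).-1)) := xx'.
Qed.

Let prob_cell x : P (cell x) = ((c ^ #|V|)%:R^-1)%:E.
Proof.
rewrite X_coloring.1// (eq_bigr (fun=> (c%:R^-1)%:E)); last first.
  by move=> v _; rewrite [LHS](X_coloring.2 v) /= ltn_ord.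
rewrite prodEFin prodr_const; congr (_%:E).
by rewrite finset.cardsT natrX exprVn.
Qed.

(** The atoms on which every vertex has a prescribed color have the same mass
    and carry the whole probability, so expectations are averages over the
    colorings. *)
Lemma expectation_coloring (g : (V -> nat) -> R) : (forall y, 0 <= g y)%R ->
  measurable_fun [set: Omega] (fun w => g (fun v => X v w)) ->
  'E_P[fun w => g (fun v => X v w)] = (mean c g)%:E.
Proof.
move=> g0 mg; pose D := \big[setU/set0]_(x : {ffun V -> 'I_c}) cell x.
have mD : measurable D by apply: bigsetU_measurable.
have onD (h : (V -> nat) -> R) : (forall y, 0 <= h y)%R ->
    measurable_fun [set: Omega] (fun w => h (fun v => X v w)) ->
    \int[P]_(w in D) (h (fun v => X v w))%:E = (mean c h)%:E.
  move=> h0 mh; rewrite ge0_integral_bigsetU//=.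
  - rewrite (eq_bigr (fun x => ((c ^ #|V|)%:R^-1 * h (shade x))%:E)).
      by rewrite sumEFin -mulr_sumr.
    move=> x _; rewrite (eq_integral (cst (h (shade x))%:E)).
      transitivity ((h (shade x))%:E * P (cell x)); first exact: integral_cst.
      by rewrite prob_cell -EFinM mulrC.
    by move=> w /[!inE]/cellP ->.
  - exact: index_enum_uniq.
  - exact: sub_trivIset trivIset_cell.
  - exact/measurable_EFinP/measurable_funTS.
  - by move=> w _; rewrite lee_fin.
have PD : P D = 1.
  by have := onD (fun=> 1%R) (fun=> ler01) (measurable_cst _);
    rewrite integral_cst// mul1e mean_cst.
rewrite unlock (@ge0_negligible_integral _ _ _ P _ (~` D))//=.
- by rewrite setTD setCK onD.
- exact: measurableC.
- exact/measurable_EFinP.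
- by move=> w _; rewrite lee_fin.
- by rewrite probability_setC// PD subee.
Qed.

End coloring_law.

Section mono_count_law.
Variables (R : realType) (d : measure_display) (Omega : measurableType d).
Variables (P : probability Omega R) (r c : nat) (H : hypergraph r).
Variable X : vertex H -> {RV P >-> nat}.
Hypotheses (c_gt0 : (0 < c)%N) (X_coloring : uniform_random_coloring P c X).

Local Notation E := (hyperedges H).

Lemma mono_countE w : mono_count R X w = (tally E (fun v => X v w))%:R.
Proof. by rewrite /mono_count /tally natr_sum. Qed.

Lemma expectation_mono_count (h : R -> R) : measurable_fun [set: R] h ->
  (forall k : nat, 0 <= h k%:R) ->
  ('E_P[h \o mono_count R X] = (mean c (fun y => h (tally E y)%:R))%:E)%E.
Proof.
move=> mh h0; rewrite -(expectation_coloring c_gt0 X_coloring)//.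
  by congr expectation; apply/funext => w; rewrite /= mono_countE.
rewrite (_ : (fun w => _) = h \o mono_count R X).
  by apply: measurableT_comp => //; exact: measurable_funP.
by apply/funext => w; rewrite /= mono_countE.
Qed.

End mono_count_law.

(** * Limits of solutions of the approximate recursion *)

(** The recursion forces [q j - a_j * q 0] to vanish in the limit, where [a_j] is
    the coefficient of the exponential series.  Summing over [j < K], where [K]
    is large, the tail bound then gives [q 0 * expR lambda --> 1]. *)
Lemma cvg_poisson_of_recursion (R : realType) (q : nat -> nat -> R)
    (mu eps : nat -> R) (lambda : R) : 0 <= lambda ->
  mu n @[n --> \oo] --> lambda -> eps n @[n --> \oo] --> 0 ->
  (\forall n \near \oo, forall j, 0 <= q j n <= 1) ->
  (\forall n \near \oo, forall j,
     `|j.+1%:R * q j.+1 n - mu n * q j n| <= eps n) ->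
  (\forall n \near \oo, forall K, (0 < K)%N ->
     1 - mu n / K%:R <= \sum_(j < K) q j n <= 1) ->
  forall j, q j n @[n --> \oo] --> exp_coeff lambda j * expR (- lambda).
Proof.
move=> lambda0 mu_cvg eps_cvg q01 recq tailq.
pose a := exp_coeff lambda.
have ratio j : (q j n - a j * q 0 n) @[n --> \oo] --> (0 : R).
  elim: j => [|j IH].
    rewrite /a /exp_coeff/= expr0 fact0 divr1.
    by under eq_fun do rewrite mul1r subrr; exact: cvg_cst.
  apply: norm_cvg0; apply: (@squeeze_cvgr _ _ _ _ (fun=> 0)
    (fun n => eps n + `|mu n - lambda| + lambda * `|q j n - a j * q 0 n|)).
  - near=> n; rewrite normr_ge0/=.
    have q1 : 0 <= q j n <= 1 by move: (j); near: n.
    have rq : `|j.+1%:R * q j.+1 n - mu n * q j n| <= eps n.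
      by move: (j); near: n.
    have aS : j.+1%:R * a j.+1 = lambda * a j.
      rewrite /a /exp_coeff/= factS natrM exprS; field.
      by rewrite nat1r !pnatr_eq0 -lt0n fact_gt0.
    apply: (@le_trans _ _
      (j.+1%:R * `|q j.+1 n - a j.+1 * q 0 n|)).
      by rewrite ler_peMl ?ler1n.
    rewrite -[X in X * `|_|]ger0_norm// -normrM mulrBr mulrA aS.
    have -> : j.+1%:R * q j.+1 n - lambda * a j * q 0 n =
      (j.+1%:R * q j.+1 n - mu n * q j n) + (mu n - lambda) * q j n +
      lambda * (q j n - a j * q 0 n) by ring.
    apply: le_trans (ler_normD _ _) _; rewrite normrM (ger0_norm lambda0) lerD2r.
    apply: le_trans (ler_normD _ _) _; rewrite lerD// normrM.
    by rewrite ler_piMr// ler_norml; lra.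
  - exact: cvg_cst.
  - rewrite -[X in _ --> X](_ : 0 + 0 + lambda * 0 = 0); last by rewrite mulr0 !addr0.
    apply: cvgD; last first.
      by apply: cvgMl_tmp; rewrite -[X in _ --> X](@normr0 R R); exact: cvg_norm.
    apply: cvgD => //; rewrite -[X in _ --> X](@normr0 R R) -(subrr lambda).
    by apply: cvg_norm; apply: cvgB => //; exact: cvg_cst.
have q0_cvg : q 0 n * expR lambda @[n --> \oo] --> (1 : R).
  apply/cvgrPdist_lt => e e0.
  have e4 : 0 < e / 4 by rewrite divr_gt0.
  have /cvgrPdist_lt/(_ _ e4) S_cvg := is_cvg_series_exp_coeff lambda.
  have inv_cvg : (lambda + 1) / n%:R @[n --> \oo] --> (0 : R).
    rewrite -[X in _ --> X](mulr0 (lambda + 1)); apply: cvgMl_tmp.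
    apply/gtr0_cvgV0; last exact: cvgr_idn.
    by near=> n; rewrite ltr0n; near: n; exact: nbhs_infty_gt.
  have /cvgr0Pnorm_lt/(_ _ e4) {}inv_cvg := inv_cvg.
  (* [K] is fixed before [n], so that only finitely many of the limits in
     [ratio] are used at once. *)
  near \oo => K; have K0 : (0 < K)%N by near: K; exact: nbhs_infty_gt.
  have SK : `|expR lambda - series a K| < e / 4 by near: K.
  have lK : `|(lambda + 1) / K%:R| < e / 4 by near: K.
  have : (\sum_(j < K) (q j n - a j * q 0 n)) @[n --> \oo] --> (0 : R).
    rewrite [X in _ --> X](_ : 0 = \sum_(j < K) 0); last by rewrite big1.
    by apply: cvg_big => //; exact: add_continuous.
  move=> /cvgr0Pnorm_lt/(_ _ e4) Kratio.
  near=> n.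
  have /(_ 0%N)/andP[q00 q0le1] : forall j, 0 <= q j n <= 1 by near: n.
  have /andP[tl tu] : 1 - mu n / K%:R <= \sum_(j < K) q j n <= 1.
    by move: (K) K0; near: n.
  have Kn : `|\sum_(j < K) (q j n - a j * q 0 n)| < e / 4 by near: n.
  have mun : mu n <= lambda + 1.
    by near: n; apply: (cvgr_le lambda) => //; rewrite ltrDl.
  have tl' : 1 - e / 4 <= \sum_(j < K) q j n.
    apply: le_trans tl; rewrite lerD2l lerN2.
    apply: le_trans (ltW (le_lt_trans (ler_norm _) lK)).
    by rewrite ler_wpM2r ?invr_ge0.
  have sumE : \sum_(j < K) (q j n - a j * q 0 n) =
      \sum_(j < K) q j n - series a K * q 0 n.
    by rewrite sumrB -mulr_suml /series/= big_mkord.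
  have q0S : `|q 0 n * (expR lambda - series a K)| < e / 4.
    rewrite normrM ger0_norm//; apply: le_lt_trans SK.
    by rewrite ler_piMl.
  rewrite sumE in Kn.
  move: Kn q0S; rewrite !ltr_norml => /andP[k1 k2] /andP[s1 s2].
  by apply/andP; split; lra.
move=> j.
have -> : q j = (fun n => (q j n - a j * q 0 n) +
    a j * expR (- lambda) * (q 0 n * expR lambda)).
  apply/funext => n.
  have -> : a j * expR (- lambda) * (q 0 n * expR lambda) =
    a j * q 0 n * (expR lambda * expR (- lambda)) by ring.
  by rewrite expRxMexpNx_1 mulr1 subrK.
rewrite -[X in _ --> X]add0r; apply: cvgD => //.
by rewrite -[X in _ --> X]mulr1; apply: cvgMl_tmp.
Unshelve. all: by end_near. Qed.

(** * Distribution functions and the limit theorem *)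

(** For [x < 0] the truncation is [0] and the condition [j%:R <= x] empties the
    sum. *)
Lemma Pois_cdf (R : realType) (lambda x : R) : 0 <= lambda ->
  Pois lambda `]-oo, x]%classic =
  (\sum_(j < (Num.truncn x).+1 | j%:R <= x) exp_coeff lambda j * expR (- lambda))%:E.
Proof.
move=> lambda0; rewrite -sumEFin.
transitivity (poisson_prob lambda 0
    (\big[setU/set0]_(j < (Num.truncn x).+1 | j%:R <= x) [set j : nat])).
  congr (poisson_prob lambda 0 _); rewrite -bigcup_pred.
  apply/seteqP; split=> k /=; rewrite /nat_to_real in_itv/=.
    move=> kx; have kM : (k < (Num.truncn x).+1)%N.
      by rewrite -(ltr_nat R); exact: le_lt_trans kx (truncnS_gt x).
    by exists (Ordinal kM).
  by case=> j /= jx ->.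
rewrite measure_bigsetU_ord//; last by move=> i j _ _ [k [/= -> ?]]; exact: val_inj.
apply: eq_bigr => j _; transitivity (poisson_prob lambda 0 [set (j : nat)]) => //.
rewrite /poisson_prob.
have [l0|] := ltP 0 lambda.
  by rewrite esum_set1 ?lee_fin ?poisson_pmf_ge0// /poisson_pmf l0.
move=> l0; have -> : lambda = 0 by apply/eqP; rewrite eq_le l0.
rewrite oppr0 expR0 mulr1 diracE /exp_coeff/= expr0n.
case: (j : nat) => [|k]; first by rewrite mem_set// fact0 divr1.
by rewrite memNset// mul0r.
Qed.

Section one_hypergraph.
Variables (R : realType) (r : nat) (H : hypergraph r) (c : nat).
Variables (d : measure_display) (Omega : measurableType d).
Variables (P : probability Omega R) (X : vertex H -> {RV P >-> nat}).
Hypotheses (r_gt1 : (1 < r)%N) (c_gt1 : (1 < c)%N).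
Hypothesis X_coloring : uniform_random_coloring P c X.

Local Notation E := (hyperedges H).
Local Notation mu := (#|E|%:R * c%:R ^- r.-1 : R).

Let c_gt0 : (0 < c)%N. Proof. exact: ltnW. Qed.

Lemma expectation_mono_countE : ('E_P[mono_count R X] = mu%:E)%E.
Proof.
rewrite -(@mean_tally R _ E r c r_gt1 c_gt1)//; last exact: hyperedges_uniform.
by rewrite -(expectation_mono_count c_gt0 X_coloring (h := id)).
Qed.

Lemma variance_mono_countE :
  ('V_P[mono_count R X] = (mean c (fun y => ((tally E y)%:R - mu) ^+ 2))%:E)%E.
Proof.
rewrite /variance covariance.unlock expectation_mono_countE.
rewrite -(expectation_mono_count c_gt0 X_coloring (h := fun t => (t - mu) ^+ 2)) //.
- by apply: measurable_funX; apply: measurable_funB => //; exact: measurable_cst.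
- by move=> k; exact: sqr_ge0.
Qed.

Lemma cdf_mono_count x : cdf (mono_count R X : {RV P >-> R}) x =
  (\sum_(j < (Num.truncn x).+1 | j%:R <= x) mean c (fun y => (tally E y == j)%:R))%:E.
Proof.
transitivity ('E_P[\1_(`]-oo, x]%classic : set R) \o mono_count R X])%E.
  rewrite -[RHS]/('E_P[\1_(mono_count R X @^-1` `]-oo, x])])%E.
  rewrite expectation_indic//.
  by rewrite -[_ @^-1` _]setTI; exact: measurable_funP.
rewrite (expectation_mono_count c_gt0 X_coloring)//.
rewrite -mean_sum; congr (_%:E); apply: eq_mean => y.
rewrite indicE mem_setE in_itv/=.
have [tx|tx] := leP (tally E y)%:R x; last first.
  by rewrite big1// => j jx; case: eqVneq => // tj; move: tx; rewrite tj ltNge jx.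
have tM : (tally E y < (Num.truncn x).+1)%N.
  by rewrite -(ltr_nat R); exact: le_lt_trans tx (truncnS_gt x).
rewrite (bigD1 (Ordinal tM))//= eqxx big1 ?addr0// => j /andP[_].
by rewrite -val_eqE/= eq_sym => /negPf ->.
Qed.

End one_hypergraph.

Theorem mainTheorem1 (R : realType) (r : nat) (hr : (2 <= r)%N)
    (H : nat -> hypergraph r)
    (edges_infty : #|hyperedges (H n)| @[n --> \oo] --> \oo)
    (c : nat -> nat) (c_infty : c n @[n --> \oo] --> \oo)
    (d : nat -> measure_display) (Omega : forall n, measurableType (d n))
    (P : forall n, probability (Omega n) R)
    (X : forall n, vertex (H n) -> {RV (P n) >-> nat})
    (X_coloring : forall n, uniform_random_coloring (P n) (c n) (X n))
    (lambda : R) (lambda_ge0 : 0 <= lambda)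
    (mean_cvg : ('E_(P n)[mono_count R (X n)])%E @[n --> \oo] --> lambda%:E)
    (var_cvg : ('V_(P n)[mono_count R (X n)])%E @[n --> \oo] --> lambda%:E) :
  cvg_in_distribution P (fun n => mono_count R (X n)) (Pois lambda).
Proof.
pose E n := hyperedges (H n).
have E_uniform n : forall e, e \in E n -> #|e| = r.
  exact: (@hyperedges_uniform _ (H n)).
pose p n : R := (c n)%:R ^- r.-1.
pose mu n : R := #|E n|%:R * p n.
pose q j n : R := mean (c n) (fun y => (tally (E n) y == j)%:R).
pose heavy_ n := heavy R (E n) (c n).
have c_gt m : \forall n \near \oo, (m < c n)%N by move/cvgnyPgt : c_infty.
have p_cvg : p n @[n --> \oo] --> (0 : R).
  apply: (@squeeze_cvgr _ _ _ _ (fun=> 0) (fun n => (c n)%:R^-1)).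
  - near=> n; have c0 : (0 < c n)%N by near: n.
    rewrite invr_ge0 exprn_ge0//= lef_pV2 ?posrE ?exprn_gt0 ?ltr0n//.
    by rewrite -natrX ler_nat -[leqLHS]expn1 leq_pexp2l// -ltnS prednK// ltnW.
  - exact: cvg_cst.
  - apply/gtr0_cvgV0; last exact/cvgrnyP.
    by near=> n; rewrite ltr0n; near: n.
have mu_cvg : mu n @[n --> \oo] --> lambda.
  apply: cvg_trans (fine_cvg mean_cvg); apply: near_eq_cvg; near=> n.
  have c1 : (1 < c n)%N by near: n.
  by rewrite /= (expectation_mono_countE hr c1 (X_coloring n)).
have mup_cvg : mu n * p n @[n --> \oo] --> (0 : R).
  by rewrite -[X in _ --> X](mulr0 lambda); exact: cvgM.
have heavy_cvg : heavy_ n @[n --> \oo] --> (0 : R).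
  apply: (@squeeze_cvgr _ _ _ _ (fun=> 0)
    (fun n => 2 * (fine ('V_(P n)[mono_count R (X n)])%E - mu n + mu n * p n))).
  - near=> n; have c1 : (1 < c n)%N by near: n.
    rewrite heavy_ge0//=.
    rewrite (variance_mono_countE hr c1 (X_coloring n)) /=.
    by have := heavy_le R hr c1 (E_uniform n).
  - exact: cvg_cst.
  - rewrite [X in _ --> X](_ : 0 = 2 * (lambda - lambda + 0)); last first.
      by rewrite subrr addr0 mulr0.
    apply: cvgMl_tmp; apply: cvgD => //; apply: cvgB => //.
    exact: fine_cvg var_cvg.
pose eps n := mu n * p n + 2 * heavy_ n +
  2 * (r%:R ^+ 2 * mu n * Num.sqrt (heavy_ n + mu n * p n)).
have eps_cvg : eps n @[n --> \oo] --> (0 : R).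
  rewrite [X in _ --> X](_ : 0 =
    0 + 2 * 0 + 2 * (r%:R ^+ 2 * lambda * Num.sqrt (0 + 0))); last first.
    by rewrite addr0 sqrtr0; ring.
  apply: cvgD; first by apply: cvgD => //; exact: cvgMl_tmp.
  apply: cvgMl_tmp; apply: cvgM; first exact: cvgMl_tmp.
  apply: continuous_cvg; first exact: sqrt_continuous.
  exact: cvgD.
have q_cvg : forall j, q j n @[n --> \oo] --> exp_coeff lambda j * expR (- lambda).
  apply: (@cvg_poisson_of_recursion _ q mu eps) => //; near=> n.
  - have c0 : (0 < c n)%N by near: n.
    move=> j; rewrite mean_ge0//= -[leRHS](mean_cst (vertex (H n)) c0).
    by apply: ler_mean => y; case: (_ == _).
  - have c1 : (1 < c n)%N by near: n.
    move=> j; apply: le_trans (tally_recursion R hr c1 (E_uniform n) j) _.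
    by rewrite lerD2l ler_wpM2l//; have := wedges_le R hr c1 (E_uniform n).
  - have c1 : (1 < c n)%N by near: n.
    by move=> K; have := tally_tail R hr c1 (E_uniform n) (K := K).
move=> x _; rewrite Pois_cdf//; apply: cvg_EFin.
  near=> n; have c1 : (1 < c n)%N by near: n.
  by rewrite (cdf_mono_count c1 (X_coloring n)).
apply: (@cvg_trans _ ((\sum_(j < (Num.truncn x).+1 | j%:R <= x) q j n) @[n --> \oo])).
  apply: near_eq_cvg; near=> n; have c1 : (1 < c n)%N by near: n.
  by rewrite /= (cdf_mono_count c1 (X_coloring n)).
by apply: cvg_big => //; exact: add_continuous.
Unshelve. all: by end_near. Qed.
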